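(* Let $K$ be a $\sigma$-field of characteristic $0$ and $n$ a positive integer. Any strictly ascending chain of radical well-mixed $\sigma$-ideals generated by pure binomials in the $\sigma$-polynomial ring $K\{y_1,\ldots,y_n\}$ is finite. That is, if $I_1\subseteq I_2\subseteq\cdots$ is an ascending chain of $\sigma$-ideals of $K\{y_1,\ldots,y_n\}$ such that each $I_k$ is of the form $\langle F_k\rangle_r$ for some set $F_k$ of pure binomials, then there is $k$ with $I_k=I_{k+1}=\cdots$.
   Context: All rings are commutative and unital; $\mathbb{N}$ contains $0$. A $\sigma$-ring is a ring $R$ with a ring endomorphism $\sigma:R\to R$; a $\sigma$-field is a $\sigma$-ring that is a field. For $p=\sum_{i=0}^s c_ix^i\in\mathbb{N}[x]$ and $a$ in a $\sigma$-ring, $a^p:=\prod_{i=0}^s(\sigma^i(a))^{c_i}$; in particular $a^{x}=\sigma(a)$ and $a^0=1$. A $\sigma$-ideal of $R$ is an ideal $I$ with $\sigma(I)\subseteq I$. A $\sigma$-ideal $I$ is well-mixed if $ab\in I$ implies $a\,\sigma(b)\in I$ for all $a,b\in R$; it is radical if it is a radical ideal in the usual sense. For $F\subseteq R$, $\langle F\rangle_r$ denotes the smallest radical well-mixed $\sigma$-ideal containing $F$. $K\{y_1,\ldots,y_n\}$ is the $\sigma$-polynomial ring: the polynomial ring over $K$ in the variables $y_i^{x^j}$ ($1\le i\le n$, $j\in\mathbb{N}$), with $\sigma$ extending that of $K$ and $\sigma(y_i^{x^j})=y_i^{x^{j+1}}$. For $\mathbf{f}=(f_1,\ldots,f_n)\in\mathbb{N}[x]^n$,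 $\mathbb{Y}^{\mathbf{f}}:=\prod_{i=1}^n y_i^{f_i}$. A pure binomial is an element $\mathbb{Y}^{\mathbf{f}}-\mathbb{Y}^{\mathbf{g}}$ with $\mathbf{f},\mathbf{g}\in\mathbb{N}[x]^n$. *)

(* Defs.v *)
From HB Require Import structures.
From mathcomp Require Import all_boot all_algebra finmap.
From mathcomp Require Import monalg.
From mathcomp Require Import boolp classical_sets.

Set Implicit Arguments.
Unset Strict Implicit.
Unset Printing Implicit Defensive.

Import GRing.Theory.
Local Open Scope ring_scope.
Local Open Scope classical_set_scope.

(* A sigma-ring is given by its underlying ring together with its endomorphism
   as an explicit argument. Ideals are Prop-valued sets, possibly equal to the
   whole ring. *)
Section SigmaIdeals.
Context (R : comPzRingType) (sigma : {rmorphism R -> R}).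
Implicit Types (F I : set R).

Definition ideal I : Prop :=
  [/\ I 0, forall a b, I a -> I b -> I (a + b) & forall r a, I a -> I (r * a)].

Definition sigma_ideal I : Prop := ideal I /\ (forall a, I a -> I (sigma a)).

Definition well_mixed I : Prop := forall a b, I (a * b) -> I (a * sigma b).

Definition radical_ideal I : Prop := forall a m, I (a ^+ m) -> I a.

Definition radical_well_mixed I : Prop :=
  [/\ sigma_ideal I, radical_ideal I & well_mixed I].

Definition rwm_closure F : set R := smallest radical_well_mixed F.

Lemma rwm_closureP F : radical_well_mixed (rwm_closure F).
Proof.
split; first split; first split.
- by move=> J [[[[]]]].
- move=> a b Ia Ib J HJ; have := HJ; case=> [[[[_ + _] _] _ _] _]; apply.
    exact: Ia.
  exact: Ib.
- by move=> r a Ia J HJ; have := HJ; case=> [[[[_ _ +] _] _ _] _]; apply; apply: Ia.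
- by move=> a Ia J HJ; have := HJ; case=> [[[_ +] _ _] _]; apply; apply: Ia.
- by move=> a m Ia J HJ; have := HJ; case=> [[_ + _] _] => /(_ a m); apply; apply: Ia.
- by move=> a b Iab J HJ; have := HJ; case=> [[_ _ +] _]; apply; apply: Iab.
Qed.

Definition sigma_exp (a : R) (p : {poly nat}) : R :=
  \prod_(i < size p) iter i sigma a ^+ (p`_i)%R.

End SigmaIdeals.

(* The monomial variable (i, j) stands for y_i^(x^j). *)
Notation sigma_poly K n := {malg K[{cmonom ('I_n * nat)%type}]}.

Section SigmaPoly.
Context (K : fieldType) (sigma : {rmorphism K -> K}) (n : nat).
Local Notation P := (sigma_poly K n).

Definition sigma_var (i : 'I_n) (j : nat) : P := << ucm (i, j) >>.

Definition shift_monom (m : {cmonom ('I_n * nat)%type}) : P :=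
  \prod_(v <- finsupp m) sigma_var v.1 v.2.+1 ^+ m v.

Lemma shift_monomE (d : {fset 'I_n * nat}) (m : {cmonom ('I_n * nat)%type}) :
  (finsupp m `<=` d)%fset ->
  shift_monom m = \prod_(v <- d) sigma_var v.1 v.2.+1 ^+ m v.
Proof.
move=> le; rewrite /shift_monom; apply: (big_fset_incl _ le) => v _.
by rewrite -cmE_eq0 => /eqP ->; rewrite expr0.
Qed.

Lemma shift_monom_mmorphism : mmorphism shift_monom.
Proof.
split=> [m1 m2|]; last by rewrite /shift_monom mdom1 big_seq_fset0.
rewrite (shift_monomE (fsubsetUl (finsupp m1) (finsupp m2))).
rewrite (shift_monomE (fsubsetUr (finsupp m1) (finsupp m2))).
rewrite {1}/shift_monom mdomD -big_split /=.
by apply: eq_bigr => v _; rewrite cmM exprD.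
Qed.

HB.instance Definition _ :=
  isMultiplicative.Build _ P shift_monom shift_monom_mmorphism.

Definition sigma_map : P -> P := mmap (malgC \o sigma) shift_monom.

HB.instance Definition _ := GRing.RMorphism.on sigma_map.

Lemma sigma_mapC (c : K) : sigma_map c%:MP = (sigma c)%:MP.
Proof. exact: mmapC. Qed.

Lemma sigma_map_var i j : sigma_map (sigma_var i j) = sigma_var i j.+1.
Proof.
rewrite /sigma_map mmapU /= rmorph1 mul1r.
by rewrite /shift_monom mdomU big_seq_fset1 cmUU expr1.
Qed.

Definition sigma_monom (f : 'I_n -> {poly nat}) : P :=
  \prod_(i < n) sigma_exp sigma_map (sigma_var i 0) (f i).

Definition pure_binomial : set P :=
  [set h | exists f g, h = sigma_monom f - sigma_monom g].

End SigmaPoly.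

Arguments sigma_map {K} sigma {n}.
Arguments sigma_monom {K} sigma {n} f.
Arguments pure_binomial {K} sigma {n}.

(* Main.v *)
(* A radical well-mixed sigma-ideal is an intersection of prime sigma-ideals, so
   a chain that does not stabilise yields prime sigma-ideals P_k and binomials
   h_k = Y^f_k - Y^g_k with h_k in P_l for all l > k but not in P_k.

   For each i the exponents d with sigma^d(y_i) outside P_k form an initial
   segment, of length t_k(i), possibly infinite. By Ramsey, after passing to a
   subsequence, each t_k(i) is nondecreasing in k and each difference
   t_k(i) - t_k(j) is either constant or tends to infinity. This orders the
   variables sigma^d(y_i) in the limit by their distance t_k(i) - d to the
   threshold, the closest ones being the largest.

   For each k choose a separating binomial that is minimal for its leading
   variable and then for its leading coefficient, with disjoint monomials. By
   Dickson there are j < k, with k arbitrarily large compared to j, such that the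
   leading variable of h_k is a shift of that of h_j and the leading coefficient
   of h_k is at least that of h_j. The shift of h_j lies in P_l, with both
   monomials outside P_l, for all l >= k: its leading variable has not reached the
   threshold, and the others are further away from theirs. Hence it can be
   subtracted from h_k, contradicting minimality. *)

Require Import Defs.
From mathcomp Require Import all_boot all_algebra monalg boolp classical_sets.
From mathcomp Require Import zify.

Set Implicit Arguments.
Unset Strict Implicit.
Unset Printing Implicit Defensive.

Import GRing.Theory.
Local Open Scope ring_scope.
Local Open Scope classical_set_scope.

(** * Extraction of subsequences and lexicographic minima *)

Section Subsequences.
Local Open Scope nat_scope.

Definition strictly_increasing (u : nat -> nat) := {homo u : i j / i < j}.

Definition const_or_incr (u : nat -> nat) :=
  (forall k, u k = u 0) \/ strictly_increasing u.

Lemma strictly_increasing_ge u k : strictly_increasing u -> k <= u k.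
Proof.
by move=> uS; elim: k => // k IH; apply: leq_ltn_trans IH (uS _ _ _).
Qed.

Lemma strictly_increasing_comp u v :
  strictly_increasing u -> strictly_increasing v -> strictly_increasing (u \o v).
Proof. by move=> uS vS i j /vS /uS. Qed.

Lemma const_or_incr_comp u v :
  const_or_incr u -> strictly_increasing v -> const_or_incr (u \o v).
Proof.
move=> [uC|uS] vS; last by right; apply: strictly_increasing_comp.
by left=> k /=; rewrite !(uC (v _)).
Qed.

Lemma const_or_incr_le u k l : const_or_incr u -> k <= l -> u k <= u l.
Proof.
move=> [uC _|uS]; first by rewrite (uC k) (uC l).
by rewrite leq_eqVlt => /predU1P[-> //|/uS/ltnW].
Qed.

Lemma const_or_incr_bounded u m :
  const_or_incr u -> (forall k, u k <= m) -> forall k, u k = u 0.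
Proof.
move=> [//|uS] um; have := leq_trans (strictly_increasing_ge m.+1 uS) (um _).
by rewrite ltnn.
Qed.

(** Either some value recurs forever, or every value occurs only finitely often and the sequence
    tends to infinity. *)
Lemma subseq_const_or_incr u :
  exists2 phi, strictly_increasing phi & const_or_incr (u \o phi).
Proof.
have iterS step k0 : (forall k, k < step k) ->
    strictly_increasing (fun s => iter s step k0).
  by move=> lt_step; apply: homo_ltn => [y x z|i]; [apply: ltn_trans|apply: lt_step].
have [[c cP]|noC] := pselect (exists c, forall N, exists2 k, N < k & u k = c).
  have [N|step stepP] := @choice _ _ (fun k l => k < l /\ u l = c).
    by have [k] := cP N; exists k.
  (* [s.+1] skips the starting point 0, where [u] need not take the value [c]. *)
  exists (fun s => iter s.+1 step 0).
    move=> i j ij; apply: (iterS step 0 (fun k => proj1 (stepP k))).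
    by rewrite ltnS.
  by left=> k /=; rewrite !(proj2 (stepP _)).
have large c : exists N, forall k, N < k -> c < u k.
  elim: c.+1 => [|d [N NP]].
    by exists 0.
  have [N' N'P] : exists N', forall k, N' < k -> u k <> d.
    apply: contrapT => H; apply: noC; exists d => m.
    apply: contrapT => H'; apply: H; exists m => k lt_mk ukd.
    by apply: H'; exists k.
  exists (maxn N N') => k; rewrite gtn_max => /andP[/NP dk /N'P ne].
  by rewrite ltn_neqAle dk andbT eq_sym; apply/eqP.
have [k|step stepP] := @choice _ _ (fun k l => k < l /\ u k < u l).
  have [N NP] := large (u k).
  by exists (maxn N k).+1; rewrite ltnS leq_maxr; split=> //; apply: NP; rewrite ltnS leq_maxl.
exists (fun s => iter s step 0); first exact: iterS (fun k => proj1 (stepP k)).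
right; apply: homo_ltn => [y x z|i /=]; first exact: ltn_trans.
exact: (proj2 (stepP _)).
Qed.

Lemma subseq_const_or_incr_fin (I : finType) (u : I -> nat -> nat) :
  exists2 phi, strictly_increasing phi & forall i, const_or_incr (u i \o phi).
Proof.
suff [phi phiS phiP] : exists2 phi, strictly_increasing phi &
    forall i, i \in enum I -> const_or_incr (u i \o phi).
  by exists phi => // i; apply: phiP; rewrite mem_enum.
elim: (enum I) => [|i s [phi phiS phiP]]; first by exists id.
have [psi psiS psiP] := subseq_const_or_incr (u i \o phi).
exists (phi \o psi); first exact: strictly_increasing_comp.
move=> j; rewrite inE => /predU1P[-> //|/phiP js].
exact: (const_or_incr_comp js psiS).
Qed.

(* [b] ranks the indices by the growth rate of [t]; indices of equal rank have
   sequences [t] that differ by constants, which [o] records. *)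
Lemma subseq_blocks n (t : nat -> 'I_n -> nat) (f : 'I_n -> nat -> nat) :
  exists phi (b o : 'I_n -> nat),
  [/\ strictly_increasing phi,
      forall i, const_or_incr (f i \o phi),
      forall i k l, k <= l -> t (phi k) i <= t (phi l) i,
      forall i j k, b i = b j -> t (phi k) i + o i = t (phi k) j + o j &
      forall i j k, 0 < k -> b i < b j -> t (phi k) i + k <= t (phi k) j].
Proof.
pose u (x : ('I_n + 'I_n + 'I_n * 'I_n)%type) k := match x with
  | inl (inl i) => f i k | inl (inr i) => t k i | inr (i, j) => t k i - t k j end.
have [phi phiS uP] := subseq_const_or_incr_fin u.
pose T k i := t (phi k) i.
have TP i j : const_or_incr (fun k => T k i - T k j) := uP (inr (i, j)).
(* [B i j] holds when [T k i] exceeds [T k j] by a bounded amount only. This is a preorder, and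
   [b i], counting the indices that fail to bound [i], ranks its classes. *)
pose B i j := `[< forall k, T k i - T k j = T 0 i - T 0 j >].
have BN i j k : ~~ B i j -> k <= T k i - T k j.
  by move=> /asboolP nB; have [//|/(strictly_increasing_ge k)] := TP i j.
have BP i j m : (forall k, T k i - T k j <= m) -> B i j.
  by move=> le; apply/asboolP; apply: const_or_incr_bounded le.
have Btrans i j l : B i j -> B j l -> B i l.
  move=> /asboolP ij /asboolP jl.
  apply: (BP _ _ ((T 0 i - T 0 j) + (T 0 j - T 0 l))) => k.
  by rewrite -(ij k) -(jl k); lia.
pose b i := #|[pred j | ~~ B i j]|.
have Bb i j : B i j -> b i <= b j.
  move=> ij; apply: subset_leq_card; apply/fintype.subsetP => l.
  by rewrite !inE; apply: contra; apply: Btrans.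
have bB i j : b i = b j -> B i j.
  move=> bij; apply: contraT => nB; have Bji : B j i.
    by apply: (BP _ _ (T 0 j)) => -[|k]; [lia|have := BN _ _ k.+1 nB; lia].
  suff: b j < b i by rewrite bij ltnn.
  apply: proper_card; apply/fintype.properP; split.
    by apply/fintype.subsetP => l; rewrite !inE; apply: contra; apply: Btrans.
  exists j; rewrite !inE // negbK; apply/asboolP => k; lia.
pose M := \max_i T 0 i.
have TM i : T 0 i <= M by apply: (@leq_bigmax _ (fun i => T 0 i)).
(* The offsets align all indices at stage 0. Within a block both truncated differences are constant,
   so the alignment persists. *)
exists phi, b, (fun i => M - T 0 i); split=> //.
- by move=> i; apply: (uP (inl (inl i))).
- by move=> i k l; apply: (const_or_incr_le (uP (inl (inr i)))).
- move=> i j k bij; have /asboolP/(_ k) ij := bB _ _ bij.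
  have /asboolP/(_ k) ji := bB _ _ (esym bij).
  have := TM i; have := TM j; rewrite -/(T k i) -/(T k j); lia.
- move=> i j k k_gt0 bij; have /(BN _ _ k) : ~~ B j i.
    by apply: contraL bij => /Bb; rewrite -leqNgt.
  by rewrite -/(T k i) -/(T k j); lia.
Qed.

Lemma exists_argmin T (D : set T) (mu : T -> nat) :
  D !=set0 -> exists2 x, D x & forall y, D y -> mu x <= mu y.
Proof.
move=> [x0 Dx0]; have [m] := ubnP (mu x0); elim: m x0 Dx0 => // m IH x0 Dx0 lt.
have [H|] := pselect (exists2 y, D y & mu y < mu x0).
  by have [y Dy ylt] := H; apply: IH Dy _; apply: leq_trans ylt _.
move=> H; exists x0 => // y Dy; rewrite leqNgt; apply/negP => ylt.
by apply: H; exists y.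
Qed.

Lemma exists_lex_argmin3 T (D : set T) (a c m : T -> nat) : D !=set0 ->
  exists2 x, D x & [/\ forall y, D y -> a x <= a y,
    forall y, D y -> a y = a x -> c x <= c y &
    forall y, D y -> a y = a x -> c y = c x -> m x <= m y].
Proof.
move=> /(exists_argmin a)[x0 Dx0 ax0].
have /(exists_argmin c)[x1 [Dx1 ax1] cx1] : [set y | D y /\ a y = a x0] !=set0.
  by exists x0.
have /(exists_argmin m)[x2 [Dx2 ax2 cx2] mx2] :
  [set y | [/\ D y, a y = a x0 & c y = c x1]] !=set0 by exists x1.
by exists x2 => //; rewrite ax2 cx2; split=> // [y Dy ay|y Dy ay cy]; [apply: cx1|apply: mx2].
Qed.

End Subsequences.

(** * Prime sigma-ideals above a radical well-mixed ideal *)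

Section PrimeSigmaIdeals.
Context (R : comPzRingType) (sigma : {rmorphism R -> R}).
Implicit Types I P : set R.

Definition prime_sigma_ideal P : Prop :=
  [/\ sigma_ideal sigma P, ~ P 1 & forall a b, P (a * b) -> P a \/ P b].

Lemma bigcup_radical_well_mixed (F : set (set R)) : F !=set0 ->
  F `<=` radical_well_mixed sigma -> total_on F subset ->
  radical_well_mixed sigma (\bigcup_(J in F) J).
Proof.
move=> [J0 FJ0] Frwm Ftot; split; first split; first split.
- by exists J0 => //; have [[[]]] := Frwm _ FJ0.
- move=> a b [J FJ Ja] [J' FJ' J'b].
  have [le|le] := Ftot _ _ FJ FJ'.
  + by exists J' => //; have [[[_ + _] _] _ _] := Frwm _ FJ'; apply=> //; apply: le.
  + by exists J => //; have [[[_ + _] _] _ _] := Frwm _ FJ; apply=> //; apply: le.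
- by move=> r a [J FJ Ja]; exists J => //; have [[[_ _ +] _] _ _] := Frwm _ FJ; apply.
- by move=> a [J FJ Ja]; exists J => //; have [[_ +] _ _] := Frwm _ FJ; apply.
- by move=> a m [J FJ Ja]; exists J => //; have [_ + _] := Frwm _ FJ; apply; apply: Ja.
- by move=> a b [J FJ Ja]; exists J => //; have [_ _ +] := Frwm _ FJ; apply.
Qed.

(** Well-mixedness of [I] is what makes the colon ideal stable under [sigma]. *)
Lemma colon_radical_well_mixed I a : radical_well_mixed sigma I ->
  radical_well_mixed sigma [set b | I (a * b)].
Proof.
move=> [[[I0 ID IM] Is] Ir Iw]; split; first split; first split.
- by rewrite /= mulr0.
- by move=> b c /= Ib Ic; rewrite mulrDr; apply: ID.
- by move=> r b /= Ib; rewrite mulrCA; apply: IM.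
- by move=> b /= /Iw.
- move=> b [|m] /= Ib; last first.
    apply: (Ir _ m.+1); rewrite exprMn exprS -mulrA mulrCA; exact: IM.
  by move: Ib; rewrite expr0 mulr1 => /(IM b); rewrite mulrC.
- by move=> b c /=; rewrite !mulrA => /Iw.
Qed.

(* A radical well-mixed ideal that is maximal among those avoiding [h] is prime:
   the colon ideals by [a] and then by [h] would contain [h]. *)
Lemma exists_prime_sigma_ideal I h : radical_well_mixed sigma I -> ~ I h ->
  exists2 P, prime_sigma_ideal P & I `<=` P /\ ~ P h.
Proof.
move=> Irwm Ih.
pose good J := [/\ radical_well_mixed sigma J, I `<=` J & ~ J h].
have [|J [Jgood Jmax]] := @Zorn_bigcup _ (fun J => J = set0 \/ good J).
  move=> F Fgood Ftot.
  have -> : \bigcup_(J in F) J = \bigcup_(J in F `&` good) J.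
    apply/seteqP; split=> x [J]; last by move=> [FJ _] Jx; exists J.
    by move=> FJ Jx; exists J => //; split=> //; have [J0|//] := Fgood _ FJ; rewrite J0 in Jx.
  have [->|/set0P F0] := eqVneq (F `&` good) set0.
    by left; rewrite bigcup_set0.
  right; split.
  - apply: bigcup_radical_well_mixed => // [J [_ []] //|J J' [FJ _] [FJ' _]].
    exact: Ftot.
  - by have [J [FJ gJ]] := F0; move=> x Ix; exists J => //; have [_ + _] := gJ; apply.
  - by move=> [J [_ [_ _ +]]].
have {Jgood} [Jrwm IJ Jh] : good J.
  case: Jgood => // J0; exfalso; apply: (Jmax I); last by right; split.
  split=> [x|/(_ 0) H]; first by rewrite J0.
  have : J 0 by apply: H; have [[[]]] := Irwm.
    by rewrite J0.
have grow J' : radical_well_mixed sigma J' -> J `<=` J' -> ~ (J' `<=` J) -> J' h.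
  move=> J'rwm JJ' nJ'J; apply: contrapT => J'h; apply: (Jmax J') => //.
  by right; split=> //; apply: subset_trans JJ'.
have [Jsig Jrad _] := Jrwm; have [[_ _ JM] _] := Jsig.
exists J => //; split=> // [J1|a b Jab].
  by apply: Jh; rewrite -[h]mulr1; apply: JM.
apply: contrapT => /not_orP[na nb]; apply: Jh.
have Jah : J (a * h).
  apply: (grow _ (colon_radical_well_mixed a Jrwm)) => [x|/(_ b)]; first exact: JM.
  by move=> H; apply: nb; apply: H.
apply: (Jrad _ 2%N); rewrite expr2.
apply: (grow _ (colon_radical_well_mixed h Jrwm)) => [x|/(_ a) H]; first exact: JM.
by apply: na; apply: H; rewrite /= mulrC.
Qed.

End PrimeSigmaIdeals.

(** * Monomials, their shifts and their membership in primes *)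

Section SigmaMonomials.
Context (R : comPzRingType) (sigma : {rmorphism R -> R}) (n : nat).
Implicit Types (f g : 'I_n -> {poly nat}) (P : set R).

(* The exponent of [sigma^d y_i] in the monomial [f]. *)
Definition expo f i d : nat := ((f i)`_d)%R.

Lemma sigma_exp_wide a (p : {poly nat}) N : (size p <= N)%N ->
  sigma_exp sigma a p = \prod_(i < N) iter i sigma a ^+ (p`_i)%R.
Proof.
move=> leN; rewrite /sigma_exp (big_ord_widen N (fun i => iter i sigma a ^+ (p`_i)%R)) //.
rewrite big_mkcond; apply: eq_bigr => i _; case: ltnP => // le.
by rewrite nth_default.
Qed.

Lemma sigma_expD a (p q : {poly nat}) :
  sigma_exp sigma a (p + q) = sigma_exp sigma a p * sigma_exp sigma a q.
Proof.
pose N := maxn (size p) (size q).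
rewrite (@sigma_exp_wide _ p N) ?leq_maxl // (@sigma_exp_wide _ q N) ?leq_maxr //.
rewrite (@sigma_exp_wide _ (p + q) N) ?size_polyD // -big_split.
by apply: eq_bigr => i _; rewrite coefD exprD.
Qed.

Lemma sigma_exp_mulX a (p : {poly nat}) :
  sigma_exp sigma a ('X * p) = sigma (sigma_exp sigma a p).
Proof.
rewrite (@sigma_exp_wide _ _ (size p).+1); last first.
  apply/leq_sizeP => -[|j] //; rewrite coefXM /= => /ltnSE le.
  by rewrite nth_default.
rewrite big_ord_recl coefXM expr0 mul1r /sigma_exp rmorph_prod.
by apply: eq_bigr => i _; rewrite coefXM rmorphXn.
Qed.

Context (y : 'I_n -> R).

Definition monom f : R := \prod_(i < n) sigma_exp sigma (y i) (f i).

Definition monom_shift s f i : {poly nat} := 'X^s * f i.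

Lemma monomD f g : monom (fun i => f i + g i) = monom f * monom g.
Proof. by rewrite /monom -big_split; apply: eq_bigr => i _; apply: sigma_expD. Qed.

Lemma monom_shiftE s f : monom (monom_shift s f) = iter s sigma (monom f).
Proof.
elim: s => [|s IH] /=; first by apply: eq_bigr => i _; rewrite /monom_shift mul1r.
rewrite -IH rmorph_prod; apply: eq_bigr => i _.
by rewrite -sigma_exp_mulX /monom_shift exprS mulrA.
Qed.

Lemma coef_monom_shift s f i d :
  expo (monom_shift s f) i d = if (d < s)%N then 0%N else expo f i (d - s).
Proof. by rewrite /expo coefXnM. Qed.

Lemma prime_monomP P f : prime_sigma_ideal sigma P ->
  P (monom f) <-> exists i d, expo f i d != 0%N /\ P (iter d sigma (y i)).
Proof.
move=> [[[_ _ PM] _] P1 PP].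
have Pprod N (F : 'I_N -> R) : P (\prod_(i < N) F i) -> exists i, P (F i).
  elim: N F => [|N IH] F; first by rewrite big_ord0.
  rewrite big_ord_recl => /PP[|/IH[i]]; first by exists ord0.
  by exists (lift ord0 i).
split=> [/Pprod[i /Pprod[d]]|[i [d [fid Pz]]]].
  move=> H; exists i, d; move: H; rewrite -/(expo f i d).
  elim: (expo f i d) => [|m IH]; first by rewrite expr0.
  by rewrite exprS => /PP[//|/IH[]].
have d_lt : (d < size (f i))%N.
  by rewrite ltnNge; apply: contra fid => le; rewrite /expo nth_default.
rewrite /monom (bigD1 i) //= mulrC; apply: (PM).
rewrite /sigma_exp (bigD1 (Ordinal d_lt)) //= mulrC; apply: (PM).
by rewrite -/(expo f i d); case: (expo f i d) fid => // m _; rewrite exprSr; apply: (PM).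
Qed.

Definition monom_cut f g i := \poly_(d < size (f i)) (expo f i d - expo g i d)%N.
Definition monom_gcd f g i := \poly_(d < size (f i)) minn (expo f i d) (expo g i d).

Lemma coef_monom_cut f g i d : expo (monom_cut f g) i d = (expo f i d - expo g i d)%N.
Proof. by rewrite {1}/expo coef_poly; case: ltnP => // le; rewrite {1}/expo (nth_default _ le) sub0n. Qed.

Lemma coef_monom_gcd f g i d : expo (monom_gcd f g) i d = minn (expo f i d) (expo g i d).
Proof. by rewrite {1}/expo coef_poly; case: ltnP => // le; rewrite {1}/expo (nth_default _ le) min0n. Qed.

Lemma eq_monom f g : (forall i d, expo f i d = expo g i d) -> monom f = monom g.
Proof. by move=> fg; apply: eq_bigr => i _; congr sigma_exp; apply/polyP => d; apply: fg. Qed.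

Lemma monom_cut_gcd f g : monom f = monom (monom_gcd f g) * monom (monom_cut f g).
Proof.
rewrite -monomD; apply: eq_monom => i d.
rewrite {2}/expo coefD -!/(expo _ i d) coef_monom_cut coef_monom_gcd.
by rewrite minnE; apply/esym/subnK/leq_subr.
Qed.

Lemma monom_gcdC f g : monom (monom_gcd f g) = monom (monom_gcd g f).
Proof. by apply: eq_monom => i d; rewrite !coef_monom_gcd minnC. Qed.

Lemma monom_degree_bound f : exists C, forall i d, expo f i d != 0%N -> (d < C)%N.
Proof.
exists (\max_i size (f i))%N => i d fid.
apply: leq_trans (@leq_bigmax _ (fun i => size (f i)) i).
by rewrite ltnNge; apply: contra fid => le; rewrite /expo nth_default.
Qed.

End SigmaMonomials.

(** * Minimal separating binomials along a sequence of primes *)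

Section PrimeSequences.
Context (R : comPzRingType) (sigma : {rmorphism R -> R}) (n : nat).
Context (y : 'I_n -> R) (P : nat -> set R).
Implicit Types (f g : 'I_n -> {poly nat}).
Local Notation ev := (monom sigma y).

(** Keeping both monomials outside the later primes allows common factors to be cancelled there. *)
Definition separates k f g : Prop :=
  (forall l, (k < l)%N -> [/\ P l (ev f - ev g), ~ P l (ev f) & ~ P l (ev g)])
  /\ ~ P k (ev f - ev g).

Context (b o : 'I_n -> nat).

(** Since [i < n], this encodes the lexicographic order on the pairs [(d + o i, i)]. The offset [o]
    makes thresholds of one block comparable. *)
Definition position i d : nat := ((d + o i) * n + i)%N.

(* A total order on the variables [sigma^d y_i], compatible with shifts, in
   which lower blocks weigh more. *)
Definition term_le i d i' d' : Prop :=
  (b i' < b i)%N \/ b i' = b i /\ (position i d <= position i' d')%N.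

Definition lead f g i d : Prop := (expo g i d < expo f i d)%N /\
  forall i' d', expo f i' d' != expo g i' d' -> term_le i' d' i d.

Lemma position_le (i i' : 'I_n) d d' :
  (position i d <= position i' d')%N -> (d + o i <= d' + o i')%N.
Proof.
rewrite /position !(leqNgt (_ + _)); apply: contra => lt.
apply: leq_trans (leq_addr i _); apply: leq_trans (leq_mul lt (leqnn n)).
by rewrite mulSn addnC ltn_add2r ltn_ord.
Qed.

Lemma position_shift i i' d d' s : (position i d <= position i' d')%N ->
  (position i (d + s) <= position i' (d' + s))%N.
Proof. by rewrite /position !mulnDl; lia. Qed.

Lemma position_inj (i i' : 'I_n) d d' : position i d = position i' d' ->
  i = i' /\ d = d'.
Proof.
move=> e; have le : (d + o i <= d' + o i')%N by apply: position_le; rewrite e.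
have le' : (d' + o i' <= d + o i)%N by apply: position_le; rewrite e.
have e1 : (d + o i = d' + o i')%N by apply/eqP; rewrite eqn_leq le le'.
move: e; rewrite /position e1 => /addnI/val_inj ii'; split=> //.
by move: e1; rewrite ii' => /addIn.
Qed.

Lemma term_le_shift i i' d d' s :
  term_le i d i' d' -> term_le i (d + s) i' (d' + s).
Proof. by move=> [lt|[e le]]; [left|right; split=> //; apply: position_shift]. Qed.

Lemma term_le_anti i d i' d' : term_le i d i' d' -> term_le i' d' i d ->
  i = i' /\ d = d'.
Proof.
move=> [lt|[e le]] [lt'|[e' le']]; [lia|lia|lia|].
by apply: position_inj; apply/eqP; rewrite eqn_leq le le'.
Qed.

Lemma exists_lead f g : (exists i d, expo f i d != expo g i d) ->
  exists i d, lead f g i d \/ lead g f i d.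
Proof.
move=> [i0 [d0 ne0]].
have [Cf fC] := monom_degree_bound f; have [Cg gC] := monom_degree_bound g.
(* Bounds every position where [f] and [g] differ, so that minimising [C - position] finds the
   highest one. *)
pose C := \max_i position i (maxn Cf Cg).
have posC i d : expo f i d != expo g i d -> (position i d <= C)%N.
  move=> ne; apply: leq_trans (@leq_bigmax _ (fun i => position i (maxn Cf Cg)) i).
  rewrite /position leq_add2r leq_mul2r leq_add2r; apply/orP; right.
  have [f0|fid] := eqVneq (expo f i d) 0%N; last by rewrite leq_max (ltnW (fC _ _ fid)).
  by rewrite leq_max orbC (ltnW (gC i d _)) // eq_sym -f0.
pose T := [set x : 'I_n * nat | expo f x.1 x.2 != expo g x.1 x.2].
have [|[i d] /= ne [bmin pmax _]] := @exists_lex_argmin3 _ T (fun x => b x.1)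
  (fun x => C - position x.1 x.2)%N (fun=> 0%N); first by exists (i0, d0).
exists i, d.
have top i' d' : expo f i' d' != expo g i' d' -> term_le i' d' i d.
  move=> ne'; have := bmin (i', d') ne'; rewrite leq_eqVlt => /predU1P[e|lt]; last by left.
  right; split=> //; have := pmax (i', d') ne' (esym e) => /=.
  by have := posC _ _ ne; have := posC _ _ ne'; lia.
move: ne; rewrite /T /= neq_ltn => /orP[lt|lt]; [right|left]; split=> // i' d' ne'.
by apply: top; rewrite eq_sym.
Qed.

Hypothesis Pprime : forall k, prime_sigma_ideal sigma (P k).

Lemma primeB_sym k a c : P k (a - c) -> P k (c - a).
Proof. by move=> ?; have [[[_ _ PM] _] _ _] := Pprime k; rewrite -opprB -mulN1r; apply: PM. Qed.

Lemma separates_sym k f g : separates k f g -> separates k g f.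
Proof.
move=> [later here]; split=> [l /later[dl fl gl]|/primeB_sym //].
by split=> //; apply: primeB_sym.
Qed.

Lemma separates_neq k f g : separates k f g ->
  exists i d, expo f i d != expo g i d.
Proof.
move=> [_ here]; apply: contrapT => H; apply: here.
rewrite (@eq_monom _ _ _ _ f g) ?subrr; first by have [[[]]] := Pprime k.
move=> i d; apply/eqP/negPn/negP => ne; apply: H; by exists i, d.
Qed.

Lemma separates_cut k f g : separates k f g ->
  separates k (monom_cut f g) (monom_cut g f).
Proof.
rewrite /separates (monom_cut_gcd _ _ f g) (monom_cut_gcd _ _ g f).
rewrite (monom_gcdC _ _ g f) -mulrBr => -[later here]; split=> [l /later[]|].
  have [[[_ _ PM] _] _ PP] := Pprime l.
  move=> dl fl gl; split; [|by move=> /PM/fl|by move=> /PM/gl].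
  by case/PP: dl => // /(PM (ev (monom_cut f g))); rewrite mulrC => /fl.
by move=> H; apply: here; have [[[_ _ +] _] _ _] := Pprime k; apply.
Qed.

Lemma exists_minimal_separating k f0 g0 : separates k f0 g0 ->
  exists f g i d, [/\ separates k f g, lead f g i d,
    forall i d, expo f i d = 0%N \/ expo g i d = 0%N &
    forall f' g' i' d', separates k f' g' -> lead f' g' i' d' ->
      term_le i d i' d' /\
      (i = i' -> d = d' ->
        expo f i d - expo g i d <= expo f' i' d' - expo g' i' d')%N].
Proof.
move=> sep0; pose T := ((('I_n -> {poly nat}) * ('I_n -> {poly nat})) * ('I_n * nat))%type.
pose D := [set x : T | separates k x.1.1 x.1.2 /\ lead x.1.1 x.1.2 x.2.1 x.2.2].
have D0 : D !=set0.
  have [i [d [l|l]]] := exists_lead (separates_neq sep0).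
    by exists ((f0, g0), (i, d)).
  by exists ((g0, f0), (i, d)); split=> //; apply: separates_sym.
(* Lower blocks weigh more, so the smallest leading variable has the largest [b], that is the least
   [B - b]. *)
pose B := \max_i b i.
have bB i : (b i <= B)%N by apply: (@leq_bigmax _ b).
have [[[f g] [i d]] [/= sep ld] [/= bmin pmin mmin]] := exists_lex_argmin3
  (fun x : T => B - b x.2.1)%N (fun x : T => position x.2.1 x.2.2)
  (fun x : T => expo x.1.1 x.2.1 x.2.2 - expo x.1.2 x.2.1 x.2.2)%N D0.
(* Cancelling the gcd makes the supports disjoint and keeps the leading variable and its
   coefficient. *)
exists (monom_cut f g), (monom_cut g f), i, d; split.
- exact: separates_cut.
- case: ld => lt top; split=> [|i' d']; rewrite !coef_monom_cut; first by lia.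
  by move=> ne; apply: top; apply: contra ne => /eqP->.
- by move=> i' d'; rewrite !coef_monom_cut; lia.
- move=> f' g' i' d' sep' ld'.
  have bm := bmin (f', g', (i', d')) (conj sep' ld').
  have pm := pmin (f', g', (i', d')) (conj sep' ld').
  have mm := mmin (f', g', (i', d')) (conj sep' ld').
  rewrite /= in bm pm mm; split.
    have := bB i; have := bB i' => bi' bi.
    move: bm; rewrite leq_eqVlt => /predU1P[e|]; last by left; lia.
    by right; split; [lia|apply: pm].
  by move=> ii' dd'; subst i' d'; have := mm erefl erefl; rewrite !coef_monom_cut; lia.
Qed.

Lemma prime_congr_shift k f g s : P k (ev f - ev g) ->
  P k (ev (monom_shift s f) - ev (monom_shift s g)).
Proof.
rewrite !monom_shiftE; have [[_ Psig] _ _] := Pprime k.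
by elim: s => //= s IH /IH/Psig; rewrite rmorphB.
Qed.

Lemma prime_congr k a c : P k (a - c) -> P k a -> P k c.
Proof.
have [[[_ PD _] _] _ _] := Pprime k; move=> /primeB_sym Pca Pa.
by rewrite -[c](subrK a); apply: PD.
Qed.

(** [fin i] says that the threshold of [y i] is finite, uniformly in [k]. By [fin_block], infinite
    thresholds sit in the higher blocks. *)
Context (t : nat -> 'I_n -> nat) (fin : 'I_n -> bool).
Hypothesis tP : forall k i d,
  P k (iter d sigma (y i)) <-> fin i /\ (t k i <= d)%N.
Hypothesis t_mono : forall i k l, (k <= l)%N -> (t k i <= t l i)%N.
Hypothesis t_block : forall i j k, b i = b j -> (t k i + o i = t k j + o j)%N.
Hypothesis t_grow : forall i j k,
  (0 < k)%N -> (b i < b j)%N -> (t k i + k <= t k j)%N.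
Hypothesis fin_block : forall i j, (b i <= b j)%N -> fin j -> fin i.

(* If the leading variable had reached its threshold at [k], shifting the
   congruence at a late prime [l] until its positive part vanishes would make the
   negative part vanish too; so the latter contains a variable at the same
   distance from its threshold, and both parts would lie in [P k]. *)
Lemma lead_notin k f g i d : separates k f g -> lead f g i d ->
  (forall i d, expo f i d = 0%N \/ expo g i d = 0%N) ->
  forall l, (k <= l)%N -> ~ P l (iter d sigma (y i)).
Proof.
move=> [later here] [lt top] disj l.
have fid : expo f i d != 0%N by rewrite -lt0n; apply: leq_ltn_trans lt.
have fin_notin l' : (k < l')%N -> ~ P l' (iter d sigma (y i)).
  move=> /later[_ fl' _] Pz; apply: fl'; apply/(prime_monomP _ _ (Pprime l')).
  by exists i, d.
rewrite leq_eqVlt => /predU1P[<-{l}|]; last exact: fin_notin.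
move=> Pz; have Pf : P k (ev f).
  by apply/(prime_monomP _ _ (Pprime k)); exists i, d.
have Pg : ~ P k (ev g).
  move=> Pg; apply: here; have [[[_ PD PM] _] _ _] := Pprime k.
  by apply: PD => //; rewrite -mulN1r; apply: PM.
have [fini tkd] := (tP k i d).1 Pz.
(* At [l > C], variables of higher blocks are too far from their thresholds for the shift of [g] to
   reach them. *)
have [C gC] := monom_degree_bound g.
have [l lE] : exists l, l = (k + C).+1 by exists (k + C).+1.
have kl : (k < l)%N by rewrite lE ltnS leq_addr.
have dl : (d < t l i)%N.
  rewrite ltnNge; apply/negP => le; apply: (fin_notin l kl).
  by apply/tP.
pose s := (t l i - d)%N.
have Pgs : P l (ev (monom_shift s g)).
  have [Pfg _ _] := later l kl.
  apply: prime_congr (prime_congr_shift s Pfg) _.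
  apply/(prime_monomP _ _ (Pprime l)); exists i, (d + s)%N; split.
    by rewrite coef_monom_shift ltnNge leq_addl addnK.
  by apply/tP; split=> //; rewrite subnKC // ltnW.
have [i' [d']] := (prime_monomP _ _ (Pprime l)).1 Pgs.
rewrite coef_monom_shift; case: ltnP => [_ []//|sd'] [gid' /tP[fini' tld']].
have ne : expo f i' (d' - s) != expo g i' (d' - s).
  by have [->|/eqP] := disj i' (d' - s)%N; [rewrite eq_sym|rewrite (negPf gid')].
have d'C := gC _ _ gid'.
have [ltb|[eb /position_le le]] := top _ _ ne.
  have := t_grow (leq_trans (ltn0Sn k) kl) ltb; rewrite /s in tld' d'C sd'; lia.
(* The variable is in the block of the leading one. Their thresholds move together, so reaching it
   at [l] after the shift means having reached it at [k] before. *)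
apply: Pg; apply/(prime_monomP _ _ (Pprime k)); exists i', (d' - s)%N; split=> //.
apply/tP; split=> //.
have := t_block k eb; have := t_block l eb; rewrite /s in tld' le sd' *; lia.
Qed.

(** The leading variable is the closest to its threshold, so the others cannot arrive first. Across
    blocks this needs [l] to exceed the degrees, hence [C]. *)
Lemma shift_notin f g i d : lead f g i d ->
  (forall i d, expo f i d = 0%N \/ expo g i d = 0%N) ->
  exists C, forall l s, (C <= l)%N -> ~ P l (iter (d + s) sigma (y i)) ->
    ~ P l (ev (monom_shift s f)) /\ ~ P l (ev (monom_shift s g)).
Proof.
move=> [lt top] disj.
have [Cf fC] := monom_degree_bound f; have [Cg gC] := monom_degree_bound g.
exists (Cf + Cg).+1 => l s Cl Pz.
have key i' d' : (d' < Cf + Cg)%N -> expo f i' d' != expo g i' d' ->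
    ~ P l (iter (d' + s) sigma (y i')).
  move=> d'C /top tle /tP[fini' le']; apply: Pz; apply/tP.
  case: tle => [ltb|[eb /position_le le]].
    split; first exact: fin_block (ltnW ltb) fini'.
    have := t_grow (leq_trans (ltn0Sn _) Cl) ltb; lia.
  split; first by apply: fin_block fini'; rewrite eb.
  have := t_block l eb; lia.
split=> /(prime_monomP _ _ (Pprime l))[i' [d']]; rewrite coef_monom_shift.
  case: ltnP => [_ []//|sd'] [fid']; rewrite -(subnK sd'); apply: key.
    by apply: leq_trans (fC _ _ fid') (leq_addr _ _).
  by have [/eqP|->//] := disj i' (d' - s)%N; rewrite (negPf fid').
case: ltnP => [_ []//|sd'] [gid']; rewrite -(subnK sd'); apply: key.
  by apply: leq_trans (gC _ _ gid') (leq_addl _ _).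
by have [->|/eqP] := disj i' (d' - s)%N; [rewrite eq_sym|rewrite (negPf gid')].
Qed.

(** Subtracts the exponent vector of [p - q] from that of [f - g], cross-multiplied to keep
    exponents natural. Including [l = k] in the hypothesis preserves the separation at [k]. *)
Lemma separates_reduce k f g p q : separates k f g ->
  (forall l, (k <= l)%N -> [/\ P l (ev p - ev q), ~ P l (ev p) & ~ P l (ev q)]) ->
  separates k (fun i => f i + q i) (fun i => g i + p i).
Proof.
move=> [later here] pq; rewrite /separates !monomD; split=> [l kl|].
  have [Pfg Pf Pg] := later l kl; have [Ppq Pp Pq] := pq l (ltnW kl).
  have [[[_ PD PM] _] _ PP] := Pprime l.
  split; [|by move=> /PP[]|by move=> /PP[]].
  have -> : ev f * ev q - ev g * ev p = ev q * (ev f - ev g) + ev g * (ev q - ev p).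
    by rewrite !mulrBr addrA (mulrC (ev q) (ev g)) subrK (mulrC (ev q)).
  by apply: PD; apply: PM => //; apply: primeB_sym.
have [Ppq Pp Pq] := pq k (leqnn k).
have [[[_ PD PM] _] _ PP] := Pprime k => H.
suff /PP[] : P k (ev q * (ev f - ev g)) by [].
have -> : ev q * (ev f - ev g) = (ev f * ev q - ev g * ev p) + ev g * (ev p - ev q).
  by rewrite !mulrBr addrA subrK (mulrC (ev q)) (mulrC (ev q) (ev g)).
by apply: PD => //; apply: PM.
Qed.

Lemma no_separating_sequence : ~ (forall k, exists f g, separates k f g).
Proof.
move=> sep.
pose T := ((('I_n -> {poly nat}) * ('I_n -> {poly nat})) * ('I_n * nat))%type.
pose good k (x : T) := [/\ separates k x.1.1 x.1.2,
  lead x.1.1 x.1.2 x.2.1 x.2.2,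
  forall i d, expo x.1.1 i d = 0%N \/ expo x.1.2 i d = 0%N &
  forall f' g' i' d', separates k f' g' -> lead f' g' i' d' ->
    term_le x.2.1 x.2.2 i' d' /\ (x.2.1 = i' -> x.2.2 = d' ->
      expo x.1.1 x.2.1 x.2.2 - expo x.1.2 x.2.1 x.2.2 <=
      expo f' i' d' - expo g' i' d')%N].
have [k|x xP] := @choice _ _ good.
  have [f0 [g0 /exists_minimal_separating[f [g [i [d fgP]]]]]] := sep k.
  by exists ((f, g), (i, d)).
(* Dickson's lemma for the index, exponent and coefficient of the leading variable. The index is
   bounded, hence constant on the subsequence. *)
pose u (r : 'I_3) k := nth 0%N [:: nat_of_ord (x k).2.1; (x k).2.2;
  (expo (x k).1.1 (x k).2.1 (x k).2.2 - expo (x k).1.2 (x k).2.1 (x k).2.2)%N] r.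
have [phi phiS uP] := subseq_const_or_incr_fin u.
have := uP 0; have := uP 1; have := uP (inord 2); rewrite /u /comp /= inordK //=.
set j := phi 0%N; move=> um ud ui.
have {ui}ui k : (x (phi k)).2.1 = (x j).2.1.
  apply/val_inj; apply: (const_or_incr_bounded (m := n) ui) => l.
  by apply: ltnW; apply: ltn_ord.
have [sepj ldj disjj _] := xP j.
have [C shiftC] := shift_notin ldj disjj.
(* Late enough to give both [j < k] and [C <= k]. *)
pose k := phi (C + j).+1.
have jk : (j < k)%N by apply: phiS.
have Ck : (C <= k)%N.
  by apply: leq_trans (strictly_increasing_ge _ phiS); rewrite leqW ?leq_addr.
have {ui}ui : (x k).2.1 = (x j).2.1 by apply: ui.
have {}ud : ((x j).2.2 <= (x k).2.2)%N by apply: (const_or_incr_le ud).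
have := const_or_incr_le um (leq0n (C + j).+1); rewrite -/k -/j => {}um.
have [sepk ldk disjk mink] := xP k.
have zk := lead_notin sepk ldk disjk.
move: ui ud um zk sepk ldk disjk mink sepj ldj disjj shiftC.
case: (x k) => [[f g] [i d]] /=; case: (x j) => [[p q] [i' dj]] /= ->{i} dle mle.
move=> zk sepk [ltk topk] disjk mink [sepj _] [ltj topj] disjj shiftC.
pose s := (d - dj)%N; have ds : (dj + s)%N = d by rewrite subnKC.
pose p' := monom_shift s p; pose q' := monom_shift s q.
have sep' : separates k (fun i => f i + q' i) (fun i => g i + p' i).
  apply: separates_reduce => // l kl.
  have [] := shiftC l s (leq_trans Ck kl); first by rewrite ds; apply: zk.
  split=> //; apply: prime_congr_shift.
  by have [] := sepj l (leq_trans jk kl).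
pose f1 := (fun i => f i + q' i); pose g1 := (fun i => g i + p' i).
have f1E i1 d1 : expo f1 i1 d1 = (expo f i1 d1 + expo q' i1 d1)%N.
  by rewrite {1}/expo coefD.
have g1E i1 d1 : expo g1 i1 d1 = (expo g i1 d1 + expo p' i1 d1)%N.
  by rewrite {1}/expo coefD.
have f1d : expo f1 i' d = (expo f i' d + expo q i' dj)%N.
  by rewrite f1E coef_monom_shift -ds ltnNge leq_addl addnK.
have g1d : expo g1 i' d = (expo g i' d + expo p i' dj)%N.
  by rewrite g1E coef_monom_shift -ds ltnNge leq_addl addnK.
have top1 i1 d1 : expo f1 i1 d1 != expo g1 i1 d1 -> term_le i1 d1 i' d.
  rewrite f1E g1E; have [eqfg ne|/topk //] := eqVneq (expo f i1 d1) (expo g i1 d1).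
  have {eqfg ne} : expo q' i1 d1 != expo p' i1 d1.
    by apply: contra ne => /eqP->; rewrite eqfg.
  rewrite !coef_monom_shift; case: ltnP => // sd1; rewrite eq_sym => /topj.
  by move=> /(term_le_shift s); rewrite subnK // ds.
(* By minimality and [top1] the new leading variable is the old one. In the first orientation its
   coefficient has strictly dropped; the second contradicts [mle]. *)
have [i1 [d1 [ld1|ld1]]] := exists_lead (separates_neq sep').
  have [le1 m1] := mink _ _ _ _ sep' ld1.
  have ne1 : expo f1 i1 d1 != expo g1 i1 d1 by rewrite neq_ltn ld1.1 orbT.
  have [e1 e2] := term_le_anti le1 (top1 _ _ ne1).
  by have := m1 e1 e2; subst i1 d1; rewrite f1d g1d; lia.
have [le1 _] := mink _ _ _ _ (separates_sym sep') ld1.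
have ne1 : expo f1 i1 d1 != expo g1 i1 d1 by rewrite neq_ltn ld1.1.
have [e1 e2] := term_le_anti le1 (top1 _ _ ne1).
by have := ld1.1; subst i1 d1; rewrite -/f1 -/g1 f1d g1d; lia.
Qed.

End PrimeSequences.

(** * From chains of ideals to sequences of primes *)

Section BinomialChains.
Context (R : comPzRingType) (sigma : {rmorphism R -> R}) (n : nat).
Context (y : 'I_n -> R).
Local Notation ev := (monom sigma y).

(* When no [sigma^d y_i] lies in [P k], [t k i] is a placeholder for infinity that
   exceeds the genuine thresholds by at least [k]. *)
Lemma exists_thresholds (P : nat -> set R) :
  (forall k, prime_sigma_ideal sigma (P k)) ->
  exists (fin : nat -> 'I_n -> bool) (t : nat -> 'I_n -> nat),
  [/\ forall k i d, P k (iter d sigma (y i)) <-> fin k i /\ (t k i <= d)%N &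
      forall k i j, fin k j -> ~~ fin k i -> (k + t k j <= t k i)%N].
Proof.
move=> Pprime.
pose fin k i := `[< exists d, P k (iter d sigma (y i)) >].
have [[k i]|t0 t0P] := @choice (nat * 'I_n)%type nat (fun x m => fin x.1 x.2 ->
  forall d, P x.1 (iter d sigma (y x.2)) <-> (m <= d)%N).
  rewrite /=; case: (boolP (fin k i)) => [/asboolP|_]; last by exists 0%N.
  move=> /(@exists_argmin _ [set d | P k (iter d sigma (y i))] id)[m Pm mmin].
  exists m => _ d; split=> [/mmin //|/subnKC <-].
  rewrite addnC iterD; have [[_ Ps] _ _] := Pprime k.
  by elim: (d - m)%N => //= e /Ps.
pose t k i := if fin k i then t0 (k, i) else (k + \max_(j | fin k j) t0 (k, j))%N.
exists fin, t; split=> [k i d|k i j fj nfi].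
  rewrite /t; split=> [Pz|[fi]]; last by rewrite fi => /(t0P (k, i) fi).
  have fi : fin k i by apply/asboolP; exists d.
  by split=> //; rewrite fi; apply/(t0P (k, i) fi).
rewrite /t fj (negPf nfi) leq_add2l.
exact: (@leq_bigmax_cond _ (fin k) (fun j => t0 (k, j))).
Qed.

(** One of the two monomials is outside [P k], since their difference is. Monotone thresholds keep
    it outside the later primes of the subsequence, and the congruence then excludes the other
    one. *)
Lemma no_binomial_prime_sequence (P : nat -> set R)
    (f g : nat -> 'I_n -> {poly nat}) :
  (forall k, prime_sigma_ideal sigma (P k)) ->
  ~ ((forall k l, (k < l)%N -> P l (ev (f k) - ev (g k))) /\
     forall k, ~ P k (ev (f k) - ev (g k))).
Proof.
move=> Pprime [later here].
have [fin [t [tP t_inf]]] := exists_thresholds Pprime.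
have [phi [b [o [phiS finS t_mono t_block t_grow]]]] :=
  subseq_blocks t (fun i k => nat_of_bool (fin k i)).
have finE k i : fin (phi k) i = fin (phi 0%N) i.
  have /(_ k) := const_or_incr_bounded (m := 1) (finS i) (fun l => leq_b1 _).
  by rewrite /=; case: (fin (phi k) i); case: (fin (phi 0%N) i).
have tP' k i d : P (phi k) (iter d sigma (y i)) <->
    fin (phi 0%N) i /\ (t (phi k) i <= d)%N by rewrite -(finE k) tP.
have notin_mono k l h : (k <= l)%N -> ~ P (phi k) (ev h) -> ~ P (phi l) (ev h).
  move=> kl Ph /(prime_monomP _ _ (Pprime _))[i [d [hid /tP'[fi le]]]]; apply: Ph.
  apply/(prime_monomP _ _ (Pprime _)); exists i, d; split=> //.
  by apply/tP'; split=> //; apply: leq_trans le; apply: t_mono.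
apply: (@no_separating_sequence _ sigma _ y (P \o phi) b o _
    (fun k => t (phi k)) (fin (phi 0%N))) => //= [i j bij fj|k].
  apply: contraT => nfi.
  have large k : (k + t (phi k) j <= t (phi k) i)%N.
    apply: leq_trans (t_inf (phi k) i j _ _); rewrite ?(finE k) //.
    by rewrite leq_add2r; apply: strictly_increasing_ge.
  (* An infinite threshold outgrows a finite one by any amount; [(o j).+1] is more than a common
     block permits. *)
  move: bij; rewrite leq_eqVlt => /predU1P[/(t_block _ _ (o j).+1)|/(t_grow _ _ 1%N isT)].
    by have := large (o j).+1; lia.
  by have := large 1%N; lia.
have [[_ PD PM] _] := let: And3 a _ _ := Pprime (phi k) in a.
exists (f (phi k)), (g (phi k)); split=> [l kl|]; last exact: here.
have Pfg : P (phi l) (ev (f (phi k)) - ev (g (phi k))) by apply: later; apply: phiS.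
have Pgf := primeB_sym Pprime Pfg.
have [Pf|Pf] := pselect (P (phi k) (ev (f (phi k)))).
  have Pg : ~ P (phi k) (ev (g (phi k))).
    move=> Pg; apply: (here (phi k)); apply: PD => //.
    by rewrite -mulN1r; apply: PM.
  have Pg' := notin_mono _ _ _ (ltnW kl) Pg.
  by split=> // Pf'; apply: Pg'; apply: (prime_congr Pprime Pfg).
have Pf' := notin_mono _ _ _ (ltnW kl) Pf.
by split=> // Pg'; apply: Pf'; apply: (prime_congr Pprime Pgf).
Qed.

Theorem binomial_rwm_chain (I : nat -> set R) :
  (forall k, I k `<=` I k.+1) ->
  (forall k, exists2 F : set R,
    (forall h, F h -> exists f g, h = ev f - ev g) & I k = rwm_closure sigma F) ->
  exists k, forall l, (k <= l)%N -> I l = I k.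
Proof.
move=> I_asc I_gen; apply: contrapT => unstable.
have I_mono k l : (k <= l)%N -> I k `<=` I l.
  by move=> /subnK <-; elim: (l - k)%N => // m IH x /IH /I_asc.
have I_rwm k : radical_well_mixed sigma (I k).
  by have [F _ ->] := I_gen k; apply: rwm_closureP.
pose M := 'I_n -> {poly nat}.
(* If every generator of each later [I l] were in [I k], minimality of the closure would give
   [I l = I k]. *)
have [k|next nextP] := @choice _ _ (fun k (x : nat * (M * M)) =>
    [/\ (k < x.1)%N, I x.1 (ev x.2.1 - ev x.2.2) & ~ I k (ev x.2.1 - ev x.2.2)]).
  apply: contrapT => none; apply: unstable; exists k => l kl.
  apply/seteqP; split; last exact: I_mono.
  have [F Fbin Il] := I_gen l; rewrite {1}Il; apply: smallest_sub => // h Fh.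
  have [f [g hE]] := Fbin h Fh.
  have Ilh : I l h by rewrite Il; exact: sub_gen_smallest Fh.
  apply: contrapT => Ikh; apply: none; exists (l, (f, g)); rewrite -hE; split=> //=.
  by rewrite ltn_neqAle kl andbT; apply/eqP => e; apply: Ikh; rewrite e.
pose kappa s := iter s (fun k => (next k).1) 0%N.
have kappaS : strictly_increasing kappa.
  by apply: homo_ltn => [? ? ?|s]; [apply: ltn_trans|have [] := nextP (kappa s)].
pose h s := ev (next (kappa s)).2.1 - ev (next (kappa s)).2.2.
have [s|P PP] := @choice _ _ (fun s P => prime_sigma_ideal sigma P /\
    I (kappa s) `<=` P /\ ~ P (h s)).
  have [_ _ nh] := nextP (kappa s).
  by have [Q ? ?] := exists_prime_sigma_ideal (I_rwm (kappa s)) nh; exists Q.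
apply: (no_binomial_prime_sequence (P := P) (f := fun s => (next (kappa s)).2.1)
  (g := fun s => (next (kappa s)).2.2)) => [s|]; first by have [] := PP s.
split=> [s l sl|s]; last by have [_ []] := PP s.
have [_ [IP _]] := PP l; apply: IP; apply: (I_mono (kappa s.+1)).
  by move: sl; rewrite leq_eqVlt => /predU1P[->//|/kappaS/ltnW].
by have [] := nextP (kappa s).
Qed.

End BinomialChains.

Theorem corollary3p16 (K : fieldType) (sigma : {rmorphism K -> K})
    (charK : [pchar K] =i pred0) (n : nat) (n_gt0 : (0 < n)%N)
    (I : nat -> set (sigma_poly K n))
    (I_asc : forall k, I k `<=` I k.+1)
    (I_gen : forall k, exists2 F : set (sigma_poly K n),
      F `<=` pure_binomial sigma & I k = rwm_closure (sigma_map sigma) F) :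
  exists k, forall l, (k <= l)%N -> I l = I k.
Proof.
by apply: (binomial_rwm_chain (sigma := sigma_map sigma)
  (y := fun i => sigma_var K i 0)) => // k; have [F] := I_gen k; exists F.
Qed.
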